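(* For each $j\in\mathbf{N}$ let $T(j)$ and $B(j)$ be $2\times 2$ real matrices, and let $(a(j))_{j\in\mathbf{N}}$ be a sequence of real $2\times 1$ vectors such that $$a(j+1)=T(j)a(j)\quad (j\in\mathbf{N}),\qquad a(j)\to 0\quad (j\to\infty),\qquad \sum_{j=1}^\infty \Vert B(j)a(j)\Vert^2<\infty .$$ Suppose further that there exists a real symmetric $2\times 2$ matrix $C$ with eigenvalues $0$ and $\lambda$, where $\lambda<0$, such that $$\frac{T(n)^tJT(m)-J}{m-n}=B(n)^tCB(m)\qquad (m\neq n;\ m,n\in\mathbf{N}).$$ Let $\phi(j)=\vert\lambda\vert^{1/2}\langle v_\lambda, B(j)a(j)\rangle$, where $v_\lambda$ is a real unit eigenvector of $C$ corresponding to $\lambda$. Then the Hankel operator $\Gamma_\phi$ on $\ell^2(\mathbf{N})$ is compact, and $K=\Gamma_\phi^2$ has entries $$K(m,n)=\frac{\langle Ja(m),a(n)\rangle}{m-n}\qquad (m\neq n;\ m,n\in\mathbf{N}).$$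
   Context: $\mathbf{N}=\{1,2,3,\dots\}$; $J=\begin{pmatrix}0&-1\\ 1&0\end{pmatrix}$; $\langle\cdot,\cdot\rangle$ and $\Vert\cdot\Vert$ are the standard inner product and norm on $\mathbf{R}^2$; $^t$ denotes transpose. For a real sequence $\phi=(\phi(j))_{j\ge 1}$, $\Gamma_\phi$ denotes the Hankel matrix $[\phi(j+k-1)]_{j,k=1}^\infty$, regarded as an operator on $\ell^2(\mathbf{N})$ with respect to the usual orthonormal basis. *)

(* Defs.v *)
From HB Require Import structures.
From mathcomp Require Import all_boot all_order all_algebra.
From mathcomp Require Import all_classical all_reals.
From mathcomp Require Import topology normedtype sequences.
From mathcomp Require Import ring lra.

Set Implicit Arguments.
Unset Strict Implicit.
Unset Printing Implicit Defensive.

Import Order.TTheory GRing.Theory Num.Theory.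
Import numFieldNormedType.Exports.

Local Open Scope classical_set_scope.
Local Open Scope ring_scope.

(* The index set {1, 2, 3, ...} is represented by [nat], where [n : nat]
   stands for the index n + 1.  Recurrences and differences of indices are
   unaffected by this shift, and the Hankel entry phi(j + k - 1) becomes
   [phi (j + k)%N]. *)

(* The matrix norm of the library is the sup norm, so the Euclidean structure
   of column vectors is defined here. *)
Definition dotcv (R : realType) (n : nat) (u v : 'cV[R]_n) : R :=
  (u^T *m v) 0 0.

Definition normcv (R : realType) (n : nat) (u : 'cV[R]_n) : R :=
  Num.sqrt (dotcv u u).

Definition Jmx (R : realType) : 'M[R]_2 := delta_mx 1 0 - delta_mx 0 1.

Definition square_summable (R : realType) (u : R^nat) : Prop :=
  cvgn (series (fun n => u n ^+ 2)).

Definition ell2_pred (R : realType) : {pred R^nat} :=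
  [pred u | `[< square_summable u >]].

Section Ell2_closed.
Variable R : realType.

Lemma ell2_predP (u : R^nat) : u \in @ell2_pred R <-> square_summable u.
Proof. by split=> /asboolP. Qed.

Lemma square_summable0 : square_summable (0 : R^nat).
Proof.
rewrite /square_summable (_ : series _ = fun=> 0); first exact: is_cvg_cst.
by apply/funext => n; rewrite seriesEnat /= big1 // => i _; rewrite expr0n.
Qed.

Lemma square_summableZ (c : R) (u : R^nat) :
  square_summable u -> square_summable (c *: u).
Proof.
move=> /(@is_cvg_seriesZ _ _ (c ^+ 2)) cu; rewrite /square_summable.
suff -> : (fun n => (c *: u) n ^+ 2) = c ^+ 2 *: (fun n => u n ^+ 2) by [].
by apply/funext => n; exact: exprMn.
Qed.

Lemma square_summableD (u v : R^nat) :
  square_summable u -> square_summable v -> square_summable (u + v).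
Proof.
move=> cu cv; have := @is_cvg_seriesZ _ _ 2 (is_cvg_seriesD cu cv).
apply: series_le_cvg => n.
- exact: sqr_ge0.
- by rewrite mulr_ge0 // addr_ge0 // sqr_ge0.
- rewrite -subr_ge0.
  suff -> : (2 *: ((fun n => u n ^+ 2) + (fun n => v n ^+ 2))) n
            - (u + v) n ^+ 2 = (u n - v n) ^+ 2 by exact: sqr_ge0.
  change (2 * (u n ^+ 2 + v n ^+ 2) - (u n + v n) ^+ 2 = (u n - v n) ^+ 2).
  by ring.
Qed.

Lemma ell2_submod_closed : submod_closed (@ell2_pred R).
Proof.
split=> [|c u v /ell2_predP cu /ell2_predP cv]; apply/ell2_predP.
  exact: square_summable0.
by apply: square_summableD => //; exact: square_summableZ.
Qed.

HB.instance Definition _ :=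
  GRing.isSubmodClosed.Build R R^nat (@ell2_pred R) ell2_submod_closed.

End Ell2_closed.

Record ell2 (R : realType) :=
  Ell2 { ell2_seq :> nat -> R ; _ : ell2_seq \in @ell2_pred R }.

HB.instance Definition _ (R : realType) := [isSub for @ell2_seq R].
HB.instance Definition _ (R : realType) := [Choice of ell2 R by <:].
HB.instance Definition _ (R : realType) :=
  [SubChoice_isSubLmodule of ell2 R by <:].

Definition dotl2 (R : realType) (u v : ell2 R) : R :=
  limn (series (fun n => u n * v n)).

Section Ell2_norm.
Variable R : realType.
Implicit Types (u v w : ell2 R) (c : R).

Lemma ell2_summable u : square_summable u.
Proof. exact/ell2_predP/valP. Qed.

Lemma ell2P u v : u =1 v -> u = v.
Proof. by move=> uv; apply/val_inj/funext. Qed.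

Lemma is_cvg_dotl2 u v : cvgn (series (fun n => u n * v n)).
Proof.
have cu : square_summable u by exact: ell2_summable.
have cv : square_summable v by exact: ell2_summable.
have cuv : square_summable (u + v) by exact: ell2_summable.
rewrite (_ : (fun n => _) = 2^-1 *: ((fun n => (u + v) n ^+ 2)
    - ((fun n => u n ^+ 2) + (fun n => v n ^+ 2)))).
  exact/is_cvg_seriesZ/is_cvg_seriesB/is_cvg_seriesD.
apply/funext => n.
change (u n * v n = 2^-1 * ((u n + v n) ^+ 2 - (u n ^+ 2 + v n ^+ 2))).
by field.
Qed.

Lemma dotl2C u v : dotl2 u v = dotl2 v u.
Proof.
by congr (limn (series _)); apply/funext => n; exact: mulrC.
Qed.

Lemma dotl2Dl u v w : dotl2 (u + v) w = dotl2 u w + dotl2 v w.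
Proof.
rewrite /dotl2 -(lim_seriesD (@is_cvg_dotl2 u w) (@is_cvg_dotl2 v w)).
by congr (limn (series _)); apply/funext => n; exact: mulrDl.
Qed.

Lemma dotl2Zl c u v : dotl2 (c *: u) v = c * dotl2 u v.
Proof.
rewrite /dotl2 -[RHS](lim_seriesZ c (@is_cvg_dotl2 u v)).
by congr (limn (series _)); apply/funext => n; rewrite /= -mulrA.
Qed.

Lemma dotl2_sqr_ge u n : u n ^+ 2 <= dotl2 u u.
Proof.
have nd : nondecreasing_seq (series (fun k => u k * u k)).
  by apply: nondecreasing_series => k _ _; rewrite -expr2 sqr_ge0.
apply: le_trans (nondecreasing_cvgn_le nd (@is_cvg_dotl2 u u) n.+1).
rewrite seriesEnat /= big_nat_recr //= -expr2 lerDr sumr_ge0 // => k _.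
by rewrite -expr2 sqr_ge0.
Qed.

Lemma dotl2_ge0 u : 0 <= dotl2 u u.
Proof. exact: le_trans (sqr_ge0 _) (dotl2_sqr_ge u 0). Qed.

Lemma dotl2_eq0 u : dotl2 u u = 0 -> u = 0.
Proof.
move=> u0; apply: ell2P => n; apply/eqP; rewrite -sqrf_eq0.
by rewrite eq_le sqr_ge0 -u0 dotl2_sqr_ge.
Qed.

Lemma dotl2_CauchySchwarz u v : dotl2 u v ^+ 2 <= dotl2 u u * dotl2 v v.
Proof.
have [v0|v_neq0] := eqVneq (dotl2 v v) 0.
  rewrite (dotl2_eq0 v0) dotl2C -(scale0r 0) !dotl2Zl !mul0r mulr0.
  by rewrite expr0n.
have v_gt0 : 0 < dotl2 v v by rewrite lt_def v_neq0 dotl2_ge0.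
have := dotl2_ge0 (dotl2 v v *: u + - dotl2 u v *: v).
rewrite dotl2Dl !dotl2Zl !(dotl2C _ (_ + _)) !dotl2Dl !dotl2Zl (dotl2C v u).
set a := dotl2 u u; set b := dotl2 u v; set d := dotl2 v v.
rewrite (_ : _ + _ = d * (a * d - b ^+ 2)); last by ring.
by rewrite pmulr_rge0 // subr_ge0.
Qed.

Definition norml2 u : R := Num.sqrt (dotl2 u u).

Lemma norml2D u v : norml2 (u + v) <= norml2 u + norml2 v.
Proof.
rewrite -(@ler_pXn2r _ 2) // ?nnegrE ?addr_ge0 ?sqrtr_ge0 //.
rewrite sqrrD !sqr_sqrtr ?dotl2_ge0 // dotl2Dl !(dotl2C _ (_ + _)) !dotl2Dl.
rewrite (dotl2C v u) -sqrtrM ?dotl2_ge0 //.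
have : dotl2 u v <= Num.sqrt (dotl2 u u * dotl2 v v).
  rewrite (le_trans (ler_norm _)) // -sqrtr_sqr.
  by rewrite ler_sqrt ?mulr_ge0 ?dotl2_ge0 // dotl2_CauchySchwarz.
by move: (Num.sqrt _) => s; lra.
Qed.

Lemma norml2Z c u : norml2 (c *: u) = `|c| * norml2 u.
Proof.
rewrite /norml2 dotl2Zl dotl2C dotl2Zl mulrA -expr2.
by rewrite sqrtrM ?sqr_ge0 // sqrtr_sqr.
Qed.

Lemma norml2_eq0 u : norml2 u = 0 -> u = 0.
Proof.
move/eqP; rewrite sqrtr_eq0 => u0; apply: dotl2_eq0.
by apply/eqP; rewrite eq_le u0 dotl2_ge0.
Qed.

HB.instance Definition _ :=
  Lmodule_isNormed.Build R (ell2 R) norml2D norml2Z norml2_eq0.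

End Ell2_norm.

Lemma ell2_delta_subproof (R : realType) (n : nat) :
  (fun k => (k == n)%:R) \in @ell2_pred R.
Proof.
apply/ell2_predP; apply/cvg_ex; exists 1 => /=.
apply: cvg_near_cst; exists n.+1 => // N /= nN.
rewrite seriesEnat /= (bigD1_seq n) ?iota_uniq //=; last first.
  by rewrite mem_index_iota.
rewrite eqxx expr1n big1 ?addr0 // => k /negbTE ->.
by rewrite expr0n.
Qed.

Definition ell2_delta (R : realType) (n : nat) : ell2 R :=
  Ell2 (ell2_delta_subproof R n).

Definition compact_operator (R : realType) (V W : normedModType R)
    (F : {linear V -> W}) : Prop :=
  forall A : set V, bounded_set A -> precompact (F @` A).

(* F acts on every vector of l^2 by the infinite matrix M, all the row series
   being convergent; at most one F has this property. *)
Definition has_matrix (R : realType) (M : nat -> nat -> R)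
    (F : ell2 R -> ell2 R) : Prop :=
  forall (u : ell2 R) (j : nat),
    series (fun k => M j k * u k) @ \oo --> F u j.

Definition hankel (R : realType) (phi : R^nat) (j k : nat) : R :=
  phi (j + k)%N.

Definition op_entry (R : realType) (F : ell2 R -> ell2 R) (m n : nat) : R :=
  dotl2 (F (ell2_delta R n)) (ell2_delta R m).

(* Main.v *)
From HB Require Import structures.
Require Import Defs.
From mathcomp Require Import all_boot all_order all_algebra.
From mathcomp Require Import all_classical all_reals.
From mathcomp Require Import topology normedtype sequences.
From mathcomp Require Import ring lra zify.

Set Implicit Arguments.
Unset Strict Implicit.
Unset Printing Implicit Defensive.

Import Order.TTheory GRing.Theory Num.Theory.
Import numFieldNormedType.Exports.

Local Open Scope classical_set_scope.
Local Open Scope ring_scope.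

(** Since [C] is symmetric with eigenvalues [0] and [lambda], it is the rank
    one matrix [lambda v v^T] ([dotcv_sym_rank1]).  Put
    [W m n = <J a(m), a(n)> / (m - n)].  Inserting [a(m)] and [a(n)] in the
    hypothesis on [T], [B] and [C] gives
    [W m n - W (m+1) (n+1) = phi m * phi n], so the sum over [k] of
    [phi (m+k) * phi (n+k)] telescopes, and since [a] tends to 0 it equals
    [W m n] for [m <> n] ([dotl2_shiftE]).  This sum is the scalar product of
    rows [m] and [n] of the Hankel matrix, hence the entry of its square.

    It remains to see that [phi], known only to be square summable, defines a
    compact operator.  Let [u] be finitely supported.  Then [|Gamma u|^2] is
    the quadratic form of the Gram matrix of the rows.  Its off-diagonal part
    is [W], that is, the Hilbert matrix [1 / (m - n)] with coefficients
    [x m * y n - y m * x n], where [x] and [y] are the coordinates of [a].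
    By Hilbert's inequality ([hilbert_wronskian_le]),
    [|Gamma u|^2 <= sum_m d m * (u m)^2] with weights
    [d m = 14 |a m|^2 + sum_k (phi (m+k))^2] ([dotl2_sum_shift_le]).  These
    weights tend to 0: the first term because [a] does, the second because it
    is a tail of a convergent series.

    A weighted bound of this kind with weights tending to 0 makes a symmetric
    matrix act compactly ([compact_matrix_op]): it extends to all of l^2 by
    letting the support grow, it makes the operator continuous on each ball of
    l^2 for the topology of coordinatewise convergence, and such a ball is
    compact for that topology by Tychonoff's theorem. *)

(** * Hilbert's inequality *)

Section HilbertInequality.
Variable R : realFieldType.
Implicit Types (x y : nat -> R) (m n k N : nat).

(** The convention [0^-1 = 0] puts zeros on the diagonal of the Hilbert matrix,
    so that no sum below has to exclude it. *)
Definition hilbert_entry m n : R := (m%:R - n%:R)^-1.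

Lemma hilbert_entryN m n : hilbert_entry n m = - hilbert_entry m n.
Proof. by rewrite /hilbert_entry -invrN opprB. Qed.

Lemma hilbert_entry_shift N m n :
  hilbert_entry (N + m) (N + n) = hilbert_entry m n.
Proof. by rewrite /hilbert_entry !natrD opprD addrACA subrr add0r. Qed.

Lemma sum_window (g : R -> R) m p :
  \sum_(n < (m + p).+1) g (m%:R - n%:R)
  = \sum_(j < m) g j.+1%:R + g 0 + \sum_(j < p) g (- j.+1%:R).
Proof.
rewrite -addnS big_split_ord /= big_ord_recl /= addn0 subrr addrA.
congr (_ + _ + _).
  rewrite (reindex_inj rev_ord_inj); apply: eq_bigr => j _ /=.
  by rewrite -natrB ?leq_subr // subKn.
apply: eq_bigr => j _; rewrite /bump /= natrD opprD addrA subrr sub0r.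
by [].
Qed.

(** The partial sums are bounded by [2 - 1/n], by induction from
    [1/(n+1)^2 <= 1/n - 1/(n+1)]. *)
Lemma sum_inv_sqr_le n : \sum_(j < n) (j.+1%:R : R)^-1 ^+ 2 <= 2.
Proof.
suff : \sum_(j < n) (j.+1%:R : R)^-1 ^+ 2 <= 2 - n%:R^-1.
  by move/le_trans; apply; rewrite gerBl invr_ge0.
elim: n => [|[|n] IHn]; first by rewrite big_ord0 invr0 subr0.
  by rewrite big_ord_recr big_ord0 /= invr1; lra.
rewrite big_ord_recr /=; apply: le_trans (lerD IHn (lexx _)) _.
have n1 : (n.+1%:R : R) > 0 by rewrite ltr0n.
have -> : (n.+2%:R : R) = n.+1%:R + 1 by rewrite -[n.+2]addn1 natrD.
move: (n.+1%:R : R) n1 => t t0.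
rewrite -subr_ge0.
have -> : 2 - (t + 1)^-1 - (2 - t^-1 + (t + 1)^-1 ^+ 2) = (t * (t + 1) ^+ 2)^-1.
  by field; apply/andP; split; apply: lt0r_neq0; lra.
by rewrite invr_ge0 mulr_ge0 ?sqr_ge0 // ltW.
Qed.

Lemma sum_hilbert_sqr_le m N : \sum_(n < N) hilbert_entry m n ^+ 2 <= 4.
Proof.
have [le1 le2] := (sum_inv_sqr_le m, sum_inv_sqr_le N).
have -> : 4 = 2 + 0 ^+ 2 + 2 :> R by ring.
apply: (@le_trans _ _ (\sum_(n < (m + N).+1) hilbert_entry m n ^+ 2)).
  rewrite -[leLHS](big_mkord xpredT (fun n => hilbert_entry m n ^+ 2)).
  rewrite -[leRHS](big_mkord xpredT (fun n => hilbert_entry m n ^+ 2)).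
  rewrite (@big_cat_nat _ _ _ N 0 (m + N).+1) //=; last first.
    by rewrite -addSn leq_addl.
  by rewrite lerDl sumr_ge0 // => *; rewrite sqr_ge0.
rewrite (sum_window (fun t => t^-1 ^+ 2)) invr0 !lerD //.
by under eq_bigr do rewrite invrN sqrrN.
Qed.

Definition harmonic_sum n : R := \sum_(j < n) j.+1%:R^-1.

Lemma harmonic_sum_lip N m k : (0 < N)%N -> (N <= k <= m)%N ->
  0 <= harmonic_sum m - harmonic_sum k <= (m%:R - k%:R) / N%:R.
Proof.
move=> N0 /andP[Nk km]; rewrite -(subnKC km); elim: (m - k)%N => [|d IHd].
  by rewrite addn0 !subrr mul0r lexx.
have step : harmonic_sum (k + d.+1) = harmonic_sum (k + d) + (k + d).+1%:R^-1.
  by rewrite /harmonic_sum addnS big_ord_recr.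
have inv0 : (0 : R) <= (k + d).+1%:R^-1 by rewrite invr_ge0.
have invN : (k + d).+1%:R^-1 <= (N%:R : R)^-1.
  by rewrite lef_pV2 ?posrE ?ltr0n // ler_nat (leq_trans Nk) // -addnS leq_addr.
have -> : (k + d.+1)%:R - k%:R = (k + d)%:R - k%:R + 1 :> R.
  by rewrite addnS -addn1 natrD; ring.
move: IHd => /andP[lo hi]; rewrite step mulrDl div1r addrAC.
by rewrite addr_ge0 //= lerD.
Qed.

Lemma sum_hilbert_window m N : (m < N)%N ->
  \sum_(n < N) hilbert_entry m n = harmonic_sum m - harmonic_sum (N - m.+1).
Proof.
move=> mN; have := sum_window (fun t => t^-1) m (N - m.+1).
rewrite -addSn subnKC // invr0 addr0 => ->.
by congr (_ + _); rewrite -sumrN; apply: eq_bigr => j _; rewrite invrN.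
Qed.

(** Scalar product of rows [m] and [k] of the Hilbert matrix, taken over a
    window of length [3 N].  It is used for [m] and [k] in the middle third
    only: far from both ends, the truncation of the sum over all integers costs
    [O(1/N)]. *)
Definition hilbert_gram N m k : R :=
  \sum_(n < 3 * N) hilbert_entry m n * hilbert_entry k n.

(** Partial fractions for [1/((m - n)(k - n))].  At [n = m] and [n = k] the
    left-hand side vanishes by convention; the indicator terms make up for
    it. *)
Lemma hilbert_entryM m k n : m != k ->
  hilbert_entry m n * hilbert_entry k n
  = hilbert_entry k m * (hilbert_entry m n - hilbert_entry k n)
    + hilbert_entry k m ^+ 2 * ((n == m)%:R + (n == k)%:R).
Proof.
move=> mk; have [->|nm] := eqVneq n m.
  by rewrite (negbTE mk) /hilbert_entry subrr invr0 /= mulr1n mulr0n; ring.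
have [->|nk] := eqVneq n k.
  rewrite (hilbert_entryN m k) /hilbert_entry subrr invr0 /= mulr1n mulr0n.
  by ring.
rewrite mulr0n addr0 mulr0 addr0 /hilbert_entry; field.
by rewrite !subr_eq0 !eqr_nat ![_ == n]eq_sym nm nk eq_sym mk.
Qed.

Lemma sum_indicator n m : (m < n)%N -> \sum_(i < n) (i == m :> nat)%:R = 1 :> R.
Proof.
move=> mn; rewrite (bigD1 (Ordinal mn)) //= eqxx big1 ?addr0 // => i.
by rewrite -val_eqE /= => /negbTE ->.
Qed.

(** Over all integers the sum would be exactly [2/(m-k)^2].  In the window, the
    partial fractions leave differences of harmonic sums at distance at least
    [N] from the ends; these are at most [(m-k)/N] each, and division by [m-k]
    leaves an error of at most [2/N]. *)
Lemma hilbert_gram_le N m k : (m < N)%N -> (k < N)%N -> m != k ->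
  `|hilbert_gram N (N + m) (N + k)| <= 2 * hilbert_entry m k ^+ 2 + 2 / N%:R.
Proof.
move=> mN kN; wlog km : m k mN kN / (k < m)%N.
  move=> W mk; have [/W->//|/W W'|mk'] := ltngtP k m; last first.
    by rewrite mk' eqxx in mk.
  rewrite hilbert_entryN sqrrN; apply: le_trans (W' _ _ _) => //; last first.
    by rewrite eq_sym.
  by rewrite /hilbert_gram; under eq_bigr do rewrite mulrC.
move=> mk.
have [m3 k3] : ((N + m < 3 * N)%N /\ (N + k < 3 * N)%N).
  by rewrite !mulSn mul0n addn0 !ltn_add2l !ltn_addr.
have N0 : (0 < N)%N by exact: leq_ltn_trans mN.
rewrite /hilbert_gram; under eq_bigr do rewrite hilbert_entryM ?eqn_add2l //.
rewrite big_split /= -!mulr_sumr sumrB big_split /= !sum_indicator //.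
rewrite !sum_hilbert_window // hilbert_entry_shift.
(* The two ends of the window contribute one difference of harmonic sums
   each. *)
have /andP[a0 aN] : 0 <= harmonic_sum (N + m) - harmonic_sum (N + k)
    <= (m%:R - k%:R) / N%:R.
  have -> : m%:R - k%:R = (N + m)%:R - (N + k)%:R :> R by rewrite !natrD; ring.
  by apply: harmonic_sum_lip; rewrite // leq_addr leq_add2l ltnW.
pose p := (3 * N - (N + k).+1)%N; pose q := (3 * N - (N + m).+1)%N.
rewrite -/p -/q.
have [pq Nq] : (k + p = m + q)%N /\ (N <= q)%N by rewrite /p /q; lia.
clearbody p q.
have qp : (q <= p)%N by rewrite -(leq_add2l k) pq leq_add2r ltnW.
have /andP[b0 bN] : 0 <= harmonic_sum p - harmonic_sum q
    <= (m%:R - k%:R) / N%:R.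
  have -> : m%:R - k%:R = p%:R - q%:R :> R.
    by apply/eqP; rewrite subr_eq addrAC eq_sym subr_eq -!natrD addnC pq addnC.
  by apply: harmonic_sum_lip; rewrite // Nq.
have mk0 : (0 : R) < m%:R - k%:R by rewrite subr_gt0 ltr_nat.
rewrite (hilbert_entryN m k) sqrrN mulNr.
rewrite [X in X + _](_ : _ = - (hilbert_entry m k * ((harmonic_sum (N + m)
  - harmonic_sum (N + k)) + (harmonic_sum p - harmonic_sum q)))); last by ring.
move: (harmonic_sum _ - _) (harmonic_sum _ - _) a0 aN b0 bN => s t s0 sN t0 tN.
have : 0 <= hilbert_entry m k * (s + t) <= 2 / N%:R.
  rewrite mulr_ge0 ?invr_ge0 ?(ltW mk0) ?addr_ge0 //= mulrC ler_pdivrMr //.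
  by rewrite -mulrA [X in _ <= 2 * X]mulrC; lra.
move/andP=> [c0 cN]; have := sqr_ge0 (hilbert_entry m k).
move: (hilbert_entry m k ^+ 2) => e e0; rewrite ler_norml.
by apply/andP; split; lra.
Qed.

Lemma schur_test N (G : nat -> nat -> R) (r : R) x :
    (forall m k, G m k = G k m) ->
    (forall m, (m < N)%N -> \sum_(k < N) `|G m k| <= r) ->
  \sum_(m < N) \sum_(k < N) x m * x k * G m k <= r * \sum_(m < N) x m ^+ 2.
Proof.
move=> Gsym Gr.
have le m k : x m * x k * G m k
    <= x m ^+ 2 * `|G m k| / 2 + x k ^+ 2 * `|G m k| / 2.
  rewrite -mulrDl -mulrDl; apply: le_trans (ler_norm _) _.
  rewrite normrM mulrAC ler_wpM2r // ler_norml.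
  have := (sqr_ge0 (x m - x k), sqr_ge0 (x m + x k)).
  by rewrite sqrrB sqrrD => -[? ?]; apply/andP; split; lra.
have half : \sum_(m < N) \sum_(k < N) x m ^+ 2 * `|G m k| / 2
    <= r / 2 * \sum_(m < N) x m ^+ 2.
  rewrite mulr_sumr ler_sum // => m _.
  rewrite -mulr_suml -mulr_sumr [leRHS]mulrC mulrA ler_pM2r ?invr_gt0 //.
  by rewrite ler_wpM2l ?sqr_ge0 // Gr.
apply: le_trans (ler_sum _ (fun (m : 'I_N) _ =>
  ler_sum _ (fun (k : 'I_N) _ => le m k))) _.
under eq_bigr do rewrite big_split /=.
rewrite big_split /= [X in _ + X]exchange_big /=.
under [X in _ + X]eq_bigr do under eq_bigr do rewrite Gsym.
by apply: le_trans (lerD half half) _; lra.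
Qed.

(** The rows [m < N] of the Hilbert matrix are shifted into the middle third
    of a window of length [3 N], which only enlarges the left-hand side.  The
    Gram matrix there has absolute row sums at most
    [4 + (2 * 4 + N * (2/N)) = 14]. *)
Lemma hilbert_inequality N x :
  \sum_(n < N) (\sum_(m < N) x m * hilbert_entry m n) ^+ 2
  <= 14 * \sum_(m < N) x m ^+ 2.
Proof.
pose G m k := hilbert_gram N (N + m) (N + k).
have -> : \sum_(n < N) (\sum_(m < N) x m * hilbert_entry m n) ^+ 2 =
   \sum_(n < N) (\sum_(m < N) x m * hilbert_entry (N + m) (N + n)) ^+ 2.
  by under [RHS]eq_bigr do under eq_bigr do rewrite hilbert_entry_shift.
pose g n := (\sum_(m < N) x m * hilbert_entry (N + m) n) ^+ 2.
apply: (@le_trans _ _ (\sum_(n < 3 * N) g n)).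
  rewrite mulSn big_split_ord /= mulSn mul1n big_split_ord /= addrCA lerDl.
  by rewrite addr_ge0 ?sumr_ge0 // => *; exact: sqr_ge0.
have -> : \sum_(n < 3 * N) g n = \sum_(m < N) \sum_(k < N) x m * x k * G m k.
  rewrite /g /G /hilbert_gram; under eq_bigr do rewrite expr2 big_distrlr /=.
  rewrite exchange_big; apply: eq_bigr => m _ /=.
  rewrite exchange_big; apply: eq_bigr => k _ /=.
  by rewrite mulr_sumr; apply: eq_bigr => n _; ring.
apply: schur_test => [m k|m mN].
  by apply: eq_bigr => n _; rewrite mulrC.
have N0 : (0 < N)%N by exact: leq_ltn_trans mN.
have Gle (k : 'I_N) : `|G m k|
    <= (k == m :> nat)%:R * 4 + (2 * hilbert_entry m k ^+ 2 + 2 / N%:R).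
  have [km|km] := eqVneq (k : nat) m; last first.
    by rewrite mul0r add0r hilbert_gram_le // eq_sym.
  rewrite mul1r ger0_norm; last first.
    by apply: sumr_ge0 => n _; rewrite km -expr2 sqr_ge0.
  apply: ler_wpDr; first by rewrite addr_ge0 // mulr_ge0 ?sqr_ge0 ?invr_ge0.
  rewrite /G km /hilbert_gram; under eq_bigr do rewrite -expr2.
  exact: sum_hilbert_sqr_le.
apply: (@le_trans _ _ (\sum_(k < N) ((k == m :> nat)%:R * 4
    + (2 * hilbert_entry m k ^+ 2 + 2 / N%:R)))); first exact: ler_sum.
rewrite big_split /= -mulr_suml sum_indicator // big_split /= -mulr_sumr.
rewrite sumr_const card_ord -[X in _ + (_ + X)]mulr_natr.
rewrite divfK ?pnatr_eq0 -?lt0n //.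
by have := sum_hilbert_sqr_le m N; lra.
Qed.

(** The kernel is skew-symmetric, so the two halves of the form agree; then
    [2 y S <= y^2 + S^2], where [S] is the transform of [x]. *)
Lemma hilbert_wronskian_le N x y :
  \sum_(m < N) \sum_(n < N) (x m * y n - y m * x n) * hilbert_entry m n
  <= 14 * \sum_(m < N) (x m ^+ 2 + y m ^+ 2).
Proof.
have -> : \sum_(m < N) \sum_(n < N) (x m * y n - y m * x n) * hilbert_entry m n
    = 2 * \sum_(n < N) y n * \sum_(m < N) x m * hilbert_entry m n.
  under eq_bigr do (under eq_bigr do rewrite mulrBl; rewrite sumrB).
  rewrite sumrB [X in X - _]exchange_big /= -sumrB mulr_sumr.
  apply: eq_bigr => n _; rewrite -sumrB mulrA mulr_sumr; apply: eq_bigr => m _.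
  by rewrite (hilbert_entryN m n); ring.
have H := hilbert_inequality N x.
rewrite big_split /= mulrDr.
have y0 : 0 <= \sum_(n < N) y n ^+ 2 by apply: sumr_ge0 => *; exact: sqr_ge0.
apply: (@le_trans _ _ (\sum_(n < N) y n ^+ 2
    + \sum_(n < N) (\sum_(m < N) x m * hilbert_entry m n) ^+ 2)); last by lra.
rewrite -big_split /= mulr_sumr; apply: ler_sum => n _.
have := sqr_ge0 (y n - \sum_(m < N) x m * hilbert_entry m n).
by rewrite sqrrB; lra.
Qed.

End HilbertInequality.

(** * Square summable sequences and their shifts *)

Section Ell2Bounds.
Variable R : realType.
Implicit Types (u w : ell2 R) (f g : R^nat) (E : R).

Lemma cvg_sum_ord (T : Type) (F : set_system T) (FF : Filter F) N
    (h : nat -> T -> R) (l : nat -> R) :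
    (forall n, h n @ F --> l n) ->
  (fun t => \sum_(n < N) h n t) @ F --> \sum_(n < N) l n.
Proof.
move=> hl; elim: N => [|N IHN].
  by under eq_fun do rewrite big_ord0; rewrite big_ord0; exact: cvg_cst.
by under eq_fun do rewrite big_ord_recr; rewrite big_ord_recr; exact: cvgD.
Qed.

Lemma cvg_dotl2 u w : series (fun n => u n * w n) @ \oo --> dotl2 u w.
Proof. exact: is_cvg_dotl2. Qed.

Lemma dotl2_ge_sum u N : \sum_(n < N) u n ^+ 2 <= dotl2 u u.
Proof.
have nd : nondecreasing_seq (series (fun n => u n * u n)).
  by apply: nondecreasing_series => n _ _; rewrite -expr2 sqr_ge0.
apply: le_trans (nondecreasing_cvgn_le nd (@is_cvg_dotl2 R u u) N).
by rewrite seriesEnat /= big_mkord.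
Qed.

Lemma square_summable_bounded f E :
  (forall N, \sum_(n < N) f n ^+ 2 <= E) -> square_summable f.
Proof.
move=> fE; apply: nondecreasing_is_cvgn.
  by apply: nondecreasing_series => n _ _; exact: sqr_ge0.
by exists E => _ [N _ <-]; rewrite seriesEnat /= big_mkord.
Qed.

Lemma dotl2_le_bound u E :
  (forall N, \sum_(n < N) u n ^+ 2 <= E) -> dotl2 u u <= E.
Proof.
move=> uE; apply: (cvgr_to_le (@cvg_dotl2 u u)).
by near=> N; rewrite seriesEnat /= big_mkord; apply: uE.
Unshelve. all: by end_near. Qed.

Lemma dotl2_suml N (c : nat -> R) (w : nat -> ell2 R) u :
  dotl2 (\sum_(m < N) c m *: w m) u = \sum_(m < N) c m * dotl2 (w m) u.
Proof.
elim: N => [|N IHN]; last by rewrite !big_ord_recr /= dotl2Dl dotl2Zl IHN.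
by rewrite !big_ord0 -(scale0r u) dotl2Zl mul0r.
Qed.

Lemma ell2_sumE N (c : nat -> R) (w : nat -> ell2 R) k :
  (\sum_(m < N) c m *: w m : ell2 R) k = \sum_(m < N) c m * w m k.
Proof.
elim: N => [|N IHN]; first by rewrite !big_ord0.
by rewrite !big_ord_recr /= -IHN.
Qed.

Lemma series_shift m f n :
  series (fun k => f (m + k)%N) n = series f (m + n)%N - series f m.
Proof.
by rewrite !seriesEnat /= !big_mkord big_split_ord /= addrAC subrr add0r.
Qed.

Lemma square_summable_shift m f :
  square_summable f -> square_summable (fun k => f (m + k)%N).
Proof.
move=> cf; rewrite /square_summable.
have -> : series (fun k => f (m + k)%N ^+ 2)
    = (fun n => series (fun k => f k ^+ 2) (n + m)%N
                - series (fun k => f k ^+ 2) m).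
  apply/funext => n; rewrite addnC.
  exact: (@series_shift m (fun k => f k ^+ 2)).
apply: is_cvgB; last exact: is_cvg_cst.
by apply/cvg_ex; exists (limn (series (fun k => f k ^+ 2))); rewrite cvg_shiftn.
Qed.

Lemma ell2_shift_subproof (phi : ell2 R) m :
  (fun k => phi (m + k)%N) \in @ell2_pred R.
Proof. exact/ell2_predP/square_summable_shift/ell2_summable. Qed.

Definition ell2_shift (phi : ell2 R) m : ell2 R :=
  Ell2 (ell2_shift_subproof phi m).

(** The squared norm of a shifted sequence is a tail of the series of
    squares. *)
Lemma cvg_dotl2_shift (phi : ell2 R) :
  (fun m => dotl2 (ell2_shift phi m) (ell2_shift phi m)) @ \oo --> (0 : R).
Proof.
pose s := series (fun k => phi k * phi k).
have -> : (fun m => dotl2 (ell2_shift phi m) (ell2_shift phi m))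
    = (fun m => dotl2 phi phi - s m).
  apply/funext => m.
  apply: (cvg_unique _ (@cvg_dotl2 (ell2_shift phi m) (ell2_shift phi m))).
    exact: Rhausdorff.
  rewrite (_ : series _ = (fun n => s (n + m)%N - s m)).
    by apply: cvgB; [rewrite (cvg_shiftn m s); exact: cvg_dotl2|exact: cvg_cst].
  apply/funext => n; rewrite addnC.
  exact: (@series_shift m (fun k => phi k * phi k)).
rewrite -(subrr (dotl2 phi phi)).
by apply: cvgB; [exact: cvg_cst|exact: cvg_dotl2].
Qed.

End Ell2Bounds.

(** * Balls of l^2 in the topology of coordinatewise convergence *)

Section Ell2Ball.
Variable R : realType.
Implicit Type rho : R.
Local Notation RN := (prod_topology (fun _ : nat => R)).

(** [rho] is the square of the radius. *)
Definition ell2_ball (rho : R) : set RN :=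
  [set f : RN | forall N, \sum_(n < N) f n ^+ 2 <= rho].

Lemma cvg_coord (f : RN) n :
  (fun g : RN => g n) @ f --> f n.
Proof. exact: (@proj_continuous _ (fun=> R) n f). Qed.

Lemma continuous_sum_sqr N :
  continuous (fun f : RN => \sum_(n < N) f n ^+ 2).
Proof.
move=> f; apply: (@cvg_sum_ord R RN (nbhs f) _ N (fun n (g : RN) => g n ^+ 2)
  (fun n => f n ^+ 2)) => n.
by rewrite expr2; apply: cvgM; exact: cvg_coord.
Qed.

(** The ball is closed in the product of the segments [[-(rho+1), rho+1]]; this
    half-length avoids a square root of [rho]. *)
Lemma compact_ell2_ball rho : compact (ell2_ball rho).
Proof.
have box : compact [set f : RN |
    forall n, `[- (rho + 1), rho + 1]%classic (f n)].
  apply: (@tychonoff nat (fun=> R) (fun=> `[- (rho + 1), rho + 1]%classic)).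
  by move=> n; exact: segment_compact.
apply: (subclosed_compact _ box) => [|f fB n /=].
  rewrite (_ : ell2_ball rho = \bigcap_(N in setT)
      ((fun f : RN => \sum_(n < N) f n ^+ 2)
         @^-1` [set t | t <= rho])).
    apply: closed_bigI => N _; apply: closed_comp; last exact: closed_le.
    by move=> f _; exact: continuous_sum_sqr.
  by apply/seteqP; split=> f fB N; [move=> _|]; exact: fB.
have := fB n.+1; rewrite big_ord_recr /=.
have s0 : 0 <= \sum_(i < n) f i ^+ 2 by apply: sumr_ge0 => *; exact: sqr_ge0.
rewrite in_itv /= => h; have r0 := fB 0; rewrite big_ord0 in r0.
have f2 : f n ^+ 2 <= (rho + 1) ^+ 2 by rewrite sqrrD; nra.
rewrite -ler_norml -(@ler_pXn2r _ 2) ?nnegrE ?addr_ge0 //.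
by rewrite real_normK ?num_real.
Qed.

(** Total, so that the operator can be composed with it on the whole product
    space; only its values on the balls matter. *)
Definition to_ell2 (f : RN) : ell2 R :=
  insubd (0 : ell2 R) (f : nat -> R).

Lemma to_ell2E rho f : ell2_ball rho f -> to_ell2 f = f :> (nat -> R).
Proof.
move=> fB; apply: insubdK.
exact/ell2_predP/(square_summable_bounded fB).
Qed.

End Ell2Ball.

Arguments to_ell2 {R} f.

(** * Compactness from a weighted bound *)

Section SymmetricMatrix.
Variables (R : realType) (r : nat -> ell2 R) (d : R^nat).
Local Notation RN := (prod_topology (fun _ : nat => R)).
Hypothesis r_sym : forall j k, r j k = r k j.
Hypothesis r_le : forall N (c : nat -> R),
  dotl2 (\sum_(m < N) c m *: r m) (\sum_(m < N) c m *: r m)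
  <= \sum_(m < N) d m * c m ^+ 2.
Hypothesis d_cvg0 : d @ \oo --> (0 : R).

Lemma weight_ge0 m : 0 <= d m.
Proof.
have := r_le m.+1 (fun k => (k == m)%:R) => /(le_trans (dotl2_ge0 _)).
rewrite (bigD1 ord_max) //= eqxx expr1n mulr1 big1 ?addr0 // => k.
by rewrite -val_eqE /= => /negbTE ->; rewrite expr0n mulr0.
Qed.

Lemma weight_bounded : exists D : R, forall m, d m <= D.
Proof.
have [M [_ dM]] := cvg_seq_bounded (cvgP _ d_cvg0).
exists (M + 1) => m; apply: le_trans (ler_norm _) _.
by apply: dM => //; rewrite ltrDl.
Qed.

(** For [u] truncated at [N], the entries of the image are the coordinates of
    the combination of rows [w = sum_m u m *: r m], because the matrix is
    symmetric; so [r_le] applies.  Then [N] goes to infinity with [J] fixed. *)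
Lemma sum_row_le (u : ell2 R) (E : R) :
    (forall N, \sum_(m < N) d m * u m ^+ 2 <= E) ->
  forall J, \sum_(j < J) dotl2 (r j) u ^+ 2 <= E.
Proof.
move=> uE J.
have cJ : (fun N => \sum_(j < J) series (fun k => r j k * u k) N ^+ 2) @ \oo
    --> \sum_(j < J) dotl2 (r j) u ^+ 2.
  apply: (@cvg_sum_ord _ _ _ _ _
    (fun j N => series (fun k => r j k * u k) N ^+ 2)
    (fun j => dotl2 (r j) u ^+ 2)) => j.
  by rewrite expr2; apply: cvgM; exact: cvg_dotl2.
apply: (cvgr_to_le cJ); near=> N.
apply: le_trans (uE N); apply: le_trans (r_le N u).
apply: le_trans (dotl2_ge_sum _ J); apply: ler_sum => j _.
rewrite ell2_sumE seriesEnat /= big_mkord.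
by under eq_bigr do rewrite mulrC r_sym.
Unshelve. all: by end_near. Qed.

Lemma weighted_sum_le (u : ell2 R) (D : R) : (forall m, d m <= D) ->
  forall N, \sum_(m < N) d m * u m ^+ 2 <= D * dotl2 u u.
Proof.
move=> dD N; have D0 : 0 <= D := le_trans (weight_ge0 0) (dD 0).
apply: (@le_trans _ _ (\sum_(m < N) D * u m ^+ 2)).
  by apply: ler_sum => m _; rewrite ler_wpM2r ?sqr_ge0.
by rewrite -mulr_sumr ler_wpM2l // dotl2_ge_sum.
Qed.

Lemma matrix_op_subproof (u : ell2 R) :
  (fun j => dotl2 (r j) u) \in @ell2_pred R.
Proof.
have [D dD] := weight_bounded.
apply/ell2_predP/(@square_summable_bounded _ _ (D * dotl2 u u)).
exact/sum_row_le/weighted_sum_le.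
Qed.

Definition matrix_op (u : ell2 R) : ell2 R := Ell2 (matrix_op_subproof u).

Lemma matrix_op_linear : linear matrix_op.
Proof.
move=> c u w; apply: ell2P => j /=.
change (dotl2 (r j) (c *: u + w) = c * dotl2 (r j) u + dotl2 (r j) w).
by rewrite dotl2C dotl2Dl dotl2Zl !(dotl2C _ (r j)).
Qed.

HB.instance Definition _ :=
  GRing.isLinear.Build R (ell2 R) (ell2 R) _ matrix_op matrix_op_linear.

Lemma dotl2_matrix_op_le (u : ell2 R) (E : R) :
  (forall N, \sum_(m < N) d m * u m ^+ 2 <= E) ->
  dotl2 (matrix_op u) (matrix_op u) <= E.
Proof. by move=> uE; apply: dotl2_le_bound => J; exact: sum_row_le. Qed.

(** For [w] the difference of two points of the ball,
    [sum_m d m * (w m)^2] is at most a sum over [m < N], small when the first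
    [N] coordinates of [w] are, plus [eta * |w|^2 <= 4 * eta * rho] when the
    weights are at most [eta] beyond [N]. *)
Lemma continuous_matrix_op_ball (rho : R) :
  {within ell2_ball rho, continuous (matrix_op \o to_ell2)}.
Proof.
apply/subspace_continuousP => f fB; apply/cvgrPdist_le => e e0 /=.
have rho0 : 0 <= rho by have := fB 0%N; rewrite big_ord0.
(* With this value, [eta + eta * (4 * rho) = e ^+ 2]. *)
pose eta := e ^+ 2 / (1 + 4 * rho).
have den0 : 0 < 1 + 4 * rho by lra.
have eta0 : 0 < eta by rewrite divr_gt0 // exprn_gt0.
have [N _ dN] := cvgr0_norm_le _ d_cvg0 _ eta0.
pose s (g : RN) :=
  \sum_(m < N) d m * (f m - g m) ^+ 2.
have s_cvg : s @ f --> (0 : R).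
  have -> : 0 = s f by rewrite /s big1 // => m _; rewrite subrr expr0n mulr0.
  apply: (@cvg_sum_ord R RN (nbhs f) _ N
    (fun m (g : RN) => d m * (f m - g m) ^+ 2)
    (fun m => d m * (f m - f m) ^+ 2)) => m.
  have cB : (fun g : RN => f m - g m) @ f --> f m - f m.
    exact: (cvgB (F := nbhs f) (cvg_cst (f m)) (@cvg_coord R f m)).
  exact: (cvgM (F := nbhs f) (cvg_cst (d m)) (cvgM cB cB)).
have s_le : \forall g \near nbhs f, `|s g| <= eta.
  exact: cvgr0_norm_le _ s_cvg _ eta0.
have {}s_le : \forall g \near within (ell2_ball rho) (nbhs f), `|s g| <= eta.
  by apply: cvg_within; exact: s_le.
have gB_near : \forall g \near within (ell2_ball rho) (nbhs f), ell2_ball rho g.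
  exact: withinT.
near=> g; have sg : `|s g| <= eta by near: g.
have gB : ell2_ball rho g by near: g.
rewrite -[X in `|X|](_ : matrix_op (to_ell2 f - to_ell2 g) = _); last first.
  exact: raddfB.
rewrite -[e](ger0_norm (ltW e0)) -sqrtr_sqr ler_sqrt ?sqr_ge0 //.
have wE m : (to_ell2 f - to_ell2 g) m = f m - g m.
  transitivity (to_ell2 f m - to_ell2 g m); first by [].
  by rewrite (to_ell2E fB) (to_ell2E gB).
have w2 n : \sum_(m < n) (f m - g m) ^+ 2 <= 4 * rho.
  apply: (@le_trans _ _ (2 * \sum_(m < n) f m ^+ 2
                         + 2 * \sum_(m < n) g m ^+ 2)).
    rewrite !mulr_sumr -big_split /=; apply: ler_sum => m _.
    by have := sqr_ge0 (f m + g m); rewrite sqrrB sqrrD; lra.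
  by have := (fB n, gB n) => -[? ?]; lra.
have -> : e ^+ 2 = eta + eta * (4 * rho).
  by rewrite /eta; field; rewrite lt0r_neq0.
apply: dotl2_matrix_op_le => M; under eq_bigr do rewrite wE.
apply: (@le_trans _ _ (\sum_(m < N + M) d m * (f m - g m) ^+ 2)).
  rewrite addnC big_split_ord /= lerDl sumr_ge0 // => m _.
  by rewrite mulr_ge0 ?sqr_ge0 ?weight_ge0.
rewrite big_split_ord lerD //=; first exact: le_trans (ler_norm _) sg.
apply: (@le_trans _ _ (eta * \sum_(m < N + M) (f m - g m) ^+ 2)); last first.
  by rewrite ler_pM2l.
rewrite big_split_ord mulrDr /=; apply: ler_wpDl.
  by rewrite mulr_ge0 ?(ltW eta0) // sumr_ge0 // => *; exact: sqr_ge0.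
rewrite mulr_sumr; apply: ler_sum => m _; rewrite ler_wpM2r ?sqr_ge0 //.
by apply: le_trans (ler_norm _) _; apply: dN; exact: leq_addr.
Unshelve. all: by end_near. Qed.

(** The image of a bounded set lies in the image of a ball, which is the
    continuous image of a compact set. *)
Lemma compact_matrix_op : compact_operator matrix_op.
Proof.
move=> A [M [_ AM]].
have [rho Arho] : exists rho : R, forall u, A u -> dotl2 u u <= rho.
  exists (Num.max 0 (M + 1) ^+ 2) => u Au.
  rewrite -[dotl2 u u]sqr_sqrtr ?dotl2_ge0 // ler_pXn2r ?nnegrE ?sqrtr_ge0 //.
    apply: le_trans (AM (M + 1) _ u Au) _; rewrite ?ltrDl //.
    by rewrite le_max lexx orbT.
  by rewrite le_max lexx.
apply: (precompact_subset (B := (matrix_op \o to_ell2) @` ell2_ball rho)).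
  move=> _ [u Au <-]; exists (u : nat -> R) => /=; last first.
    by congr matrix_op; exact: valKd.
  by move=> N; apply: le_trans (Arho u Au); exact: dotl2_ge_sum.
apply: compact_precompact; first exact: norm_hausdorff.
apply: continuous_compact; first exact: continuous_matrix_op_ball.
exact: compact_ell2_ball.
Qed.

End SymmetricMatrix.

(** * The Euclidean plane *)

Section Plane.
Variable R : realType.
Implicit Types (u w z v : 'cV[R]_2) (C : 'M[R]_2).

Lemma sum_ord2 (F : 'I_2 -> R) : \sum_i F i = F 0 + F 1.
Proof.
by rewrite !big_ord_recl big_ord0 addr0; congr (_ + F _); apply: val_inj.
Qed.

Lemma dotcv2E u w : dotcv u w = u 0 0 * w 0 0 + u 1 0 * w 1 0.
Proof. by rewrite /dotcv mxE sum_ord2 !mxE. Qed.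

Lemma mulmx2E C u i : (C *m u) i 0 = C i 0 * u 0 0 + C i 1 * u 1 0.
Proof. by rewrite mxE sum_ord2. Qed.

Lemma dotcv_mulmx2 u C w :
  dotcv u (C *m w) = u 0 0 * (C 0 0 * w 0 0 + C 0 1 * w 1 0)
                     + u 1 0 * (C 1 0 * w 0 0 + C 1 1 * w 1 0).
Proof. by rewrite dotcv2E !mulmx2E. Qed.

Lemma dotcv_trmx u C w : dotcv u (C^T *m w) = dotcv (C *m u) w.
Proof. by rewrite /dotcv trmx_mul mulmxA. Qed.

Lemma dotcvC u w : dotcv u w = dotcv w u.
Proof. by rewrite !dotcv2E; ring. Qed.

Lemma dotcvBr u w z : dotcv u (w - z) = dotcv u w - dotcv u z.
Proof. by rewrite !dotcv2E !mxE; ring. Qed.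

Lemma dotcvZr c u w : dotcv u (c *: w) = c * dotcv u w.
Proof. by rewrite !dotcv2E !mxE; ring. Qed.

Lemma dotcv_Jmx u w : dotcv (Jmx R *m u) w = u 0 0 * w 1 0 - u 1 0 * w 0 0.
Proof. by rewrite dotcv2E !mulmx2E !mxE /=; ring. Qed.

Lemma normcv_sqr u : normcv u ^+ 2 = dotcv u u.
Proof.
by rewrite sqr_sqrtr // dotcv2E -!expr2 addr_ge0 ?sqr_ge0.
Qed.

Lemma dotcv2_sqr_le v u : normcv v = 1 -> dotcv v u ^+ 2 <= normcv u ^+ 2.
Proof.
move=> v1; have := normcv_sqr v; rewrite v1 expr1n normcv_sqr !dotcv2E => v11.
have := sqr_ge0 (v 0 0 * u 1 0 - v 1 0 * u 0 0).
move: (v 0 0) (v 1 0) (u 0 0) (u 1 0) v11 => a b x y ab h.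
have -> : x * x + y * y = (a * a + b * b) * (x * x + y * y).
  by rewrite -ab mul1r.
rewrite -subr_ge0 (_ : _ - _ = (a * y - b * x) ^+ 2) //; ring.
Qed.

(** A vector killed by [C] on the left shows that [det C = 0].  Then, as
    [lambda != 0], the rows of [C] are multiples of [v], and the eigenvalue
    equation with [|v| = 1] gives the entries [lambda * v i * v j]. *)
Lemma dotcv_sym_rank1 C (lambda : R) v u w : lambda != 0 ->
    C^T = C -> eigenvalue C 0 -> C *m v = lambda *: v -> normcv v = 1 ->
  dotcv u (C *m w) = lambda * (dotcv v u * dotcv v w).
Proof.
move=> l0 Csym /eigenvalueP[p]; rewrite scale0r => pC p0 Cv v1.
have C10 : C 1 0 = C 0 1 by rewrite -{1}Csym mxE.
have := normcv_sqr v; rewrite v1 expr1n dotcv2E => vv.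
have := congr1 (fun M : 'cV_2 => M 0 0) Cv.
have := congr1 (fun M : 'cV_2 => M 1 0) Cv.
rewrite /= !mulmx2E C10 ![(lambda *: v) _ _]mxE => Cv1 Cv0.
have := congr1 (fun M : 'rV_2 => M 0 0) pC.
have := congr1 (fun M : 'rV_2 => M 0 1) pC.
rewrite /= !mxE !sum_ord2 C10 => pC1 pC0.
have pp : p 0 0 != 0 \/ p 0 1 != 0.
  have [p00|] := eqVneq (p 0 0) 0; last by left.
  right; apply: contraNneq p0 => p01; apply/eqP/rowP => i; rewrite mxE.
  case: i => [[|[|//]] i2]; [rewrite -p00|rewrite -p01];
    by congr (p _ _); apply: val_inj.
rewrite dotcv_mulmx2 !dotcv2E C10.
move: (C 0 0) (C 0 1) (C 1 1) (v 0 0) (v 1 0) (p 0 0) (p 0 1)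
  vv Cv1 Cv0 pC1 pC0 pp => a b c s t p0' p1 vv Cv1 Cv0 pC1 pC0 pp.
have det0 : a * c - b ^+ 2 = 0.
  have [q0|q0] := pp; apply: (mulfI q0); rewrite mulr0.
    transitivity (c * (p0' * a + p1 * b) - b * (p0' * b + p1 * c)).
      by ring.
    by rewrite pC0 pC1; ring.
  transitivity (a * (p0' * b + p1 * c) - b * (p0' * a + p1 * b)); first by ring.
  by rewrite pC0 pC1; ring.
have ats : a * t = b * s.
  apply/eqP; rewrite -subr_eq0; apply/eqP/(mulfI l0); rewrite mulr0.
  transitivity (a * (lambda * t) - b * (lambda * s)); first by ring.
  rewrite -Cv1 -Cv0; transitivity (t * (a * c - b ^+ 2)); first by ring.
  by rewrite det0 mulr0.
have cs : c * s = b * t.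
  apply/eqP; rewrite -subr_eq0; apply/eqP/(mulfI l0); rewrite mulr0.
  transitivity (c * (lambda * s) - b * (lambda * t)); first by ring.
  rewrite -Cv1 -Cv0; transitivity (s * (a * c - b ^+ 2)); first by ring.
  by rewrite det0 mulr0.
have aE : a = lambda * s ^+ 2.
  rewrite -[LHS]mulr1 vv.
  transitivity (s * (a * s) + t * (a * t)); first by ring.
  by rewrite ats; transitivity (s * (lambda * s)); [rewrite -Cv0|]; ring.
have bE : b = lambda * s * t.
  rewrite -[LHS]mulr1 vv -Cv0.
  transitivity (s * (b * s) + b * t * t); first by ring.
  by rewrite -ats; ring.
have cE : c = lambda * t ^+ 2.
  rewrite -[LHS]mulr1 vv.
  transitivity (s * (c * s) + t * (c * t)); first by ring.
  by rewrite cs; transitivity (t * (lambda * t)); [rewrite -Cv1|]; ring.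
by rewrite aE bE cE; ring.
Qed.

End Plane.

(** * Hankel operators whose square is a Wronskian kernel *)

Section HankelSquare.
Variables (R : realType) (phi : ell2 R) (x y : R^nat).
Hypothesis x_cvg0 : x @ \oo --> (0 : R).
Hypothesis y_cvg0 : y @ \oo --> (0 : R).

Definition wronskian_entry m n : R :=
  (x m * y n - y m * x n) * hilbert_entry R m n.

Hypothesis wronskian_step : forall m n, m <> n ->
  wronskian_entry m n - wronskian_entry m.+1 n.+1 = phi m * phi n.

Lemma cvg_wronskian_entry m n :
  (fun k => wronskian_entry (m + k) (n + k)) @ \oo --> (0 : R).
Proof.
have -> : (fun k => wronskian_entry (m + k) (n + k)) = (fun k =>
    (x (k + m)%N * y (k + n)%N - y (k + m)%N * x (k + n)%N)
    * hilbert_entry R m n).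
  apply/funext => k; rewrite /wronskian_entry -(hilbert_entry_shift R k m n).
  by rewrite ![(k + _)%N]addnC.
have cs (f : R^nat) i : f @ \oo --> (0 : R) ->
  (fun k => f (k + i)%N) @ \oo --> (0 : R) by rewrite -(cvg_shiftn i).
rewrite [X in _ --> X](_ : 0 = (0 * 0 - 0 * 0) * hilbert_entry R m n :> R);
    last first.
  by rewrite mul0r subrr mul0r.
by apply: cvgM; [apply: cvgB; apply: cvgM; exact: cs|exact: cvg_cst].
Qed.

Lemma dotl2_shiftE m n : m <> n ->
  dotl2 (ell2_shift phi m) (ell2_shift phi n) = wronskian_entry m n.
Proof.
move=> mn.
apply: (cvg_unique _ (@cvg_dotl2 _ (ell2_shift phi m) (ell2_shift phi n))).
  exact: Rhausdorff.
have -> : series (fun k => ell2_shift phi m k * ell2_shift phi n k)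
    = (fun J => wronskian_entry m n - wronskian_entry (m + J) (n + J)).
  apply/funext => J; rewrite seriesEnat /= big_mkord.
  elim: J => [|J IHJ]; first by rewrite big_ord0 !addn0 subrr.
  rewrite big_ord_recr /= IHJ -wronskian_step; last by move/addIn.
  by rewrite !addnS; ring.
have := cvgB (cvg_cst (wronskian_entry m n)) (@cvg_wronskian_entry m n).
by rewrite subr0; apply.
Qed.

Definition hankel_weight m : R :=
  14 * (x m ^+ 2 + y m ^+ 2) + dotl2 (ell2_shift phi m) (ell2_shift phi m).

Lemma cvg_hankel_weight : hankel_weight @ \oo --> (0 : R).
Proof.
rewrite [X in _ --> X](_ : 0 = 14 * (0 * 0 + 0 * 0) + 0 :> R); last by ring.
have -> : hankel_weight = fun m => 14 * (x m * x m + y m * y m)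
    + dotl2 (ell2_shift phi m) (ell2_shift phi m).
  by apply/funext => m; rewrite /hankel_weight !expr2.
apply: cvgD; last exact: cvg_dotl2_shift.
by apply: cvgM; [exact: cvg_cst|apply: cvgD; apply: cvgM].
Qed.

(** The Gram matrix of the shifts is split into its diagonal and the
    off-diagonal Wronskian part, to which Hilbert's inequality applies with
    [c m * x m] and [c m * y m]. *)
Lemma dotl2_sum_shift_le N (c : nat -> R) :
  dotl2 (\sum_(m < N) c m *: ell2_shift phi m)
        (\sum_(m < N) c m *: ell2_shift phi m)
  <= \sum_(m < N) hankel_weight m * c m ^+ 2.
Proof.
rewrite dotl2_suml.
have termE m n : c m * c n * dotl2 (ell2_shift phi m) (ell2_shift phi n)
    = (n == m)%:R * (c m ^+ 2 * dotl2 (ell2_shift phi m) (ell2_shift phi m))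
      + ((c m * x m) * (c n * y n) - (c m * y m) * (c n * x n))
        * hilbert_entry R m n.
  have [->|nm] := eqVneq n m.
    by rewrite mul1r /hilbert_entry subrr invr0 mulr0 addr0.
  rewrite mul0r add0r dotl2_shiftE; last by move/esym/eqP; exact/negP.
  by rewrite /wronskian_entry; ring.
have -> : \sum_(m < N) c m * dotl2 (ell2_shift phi m)
      (\sum_(m < N) c m *: ell2_shift phi m)
    = \sum_(m < N) c m ^+ 2 * dotl2 (ell2_shift phi m) (ell2_shift phi m)
      + \sum_(m < N) \sum_(n < N) ((c m * x m) * (c n * y n)
          - (c m * y m) * (c n * x n)) * hilbert_entry R m n.
  rewrite -big_split; apply: eq_bigr => m _ /=.
  rewrite dotl2C dotl2_suml mulr_sumr.
  under [LHS]eq_bigr => n _ do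
    rewrite mulrA [dotl2 _ (ell2_shift phi m)]dotl2C termE.
  by rewrite big_split /= -mulr_suml sum_indicator // mul1r.
apply: le_trans (lerD (lexx _) (hilbert_wronskian_le N
  (fun m => c m * x m) (fun m => c m * y m))) _.
rewrite mulr_sumr -big_split /= le_eqVlt; apply/orP; left; apply/eqP.
by apply: eq_bigr => m _; rewrite /hankel_weight; ring.
Qed.

Let shift_sym j k : ell2_shift phi j k = ell2_shift phi k j.
Proof. by rewrite /= addnC. Qed.

(** Row [m] of the Hankel matrix of [phi] is the shift of [phi] by [m], so the
    entries of the square are the scalar products of the shifts. *)
Lemma hankel_square : exists Gamma : {linear ell2 R -> ell2 R},
  [/\ has_matrix (hankel phi) Gamma, compact_operator Gamma &
      forall m n, m <> n ->
        op_entry (Gamma \o Gamma) m n = wronskian_entry m n].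
Proof.
exists (matrix_op shift_sym dotl2_sum_shift_le cvg_hankel_weight); split.
- by move=> u j; exact: (@cvg_dotl2 _ (ell2_shift phi j) u).
- exact: compact_matrix_op.
move=> m n mn; rewrite -dotl2_shiftE //.
set Gamma := matrix_op _ _ _.
have deltaE (u : ell2 R) k : dotl2 u (ell2_delta R k) = u k.
  apply: (cvg_unique _ (@cvg_dotl2 _ u (ell2_delta R k))).
    exact: Rhausdorff.
  apply: cvg_near_cst; exists k.+1 => // N /= kN.
  rewrite seriesEnat /= big_mkord (bigD1 (Ordinal kN)) //= eqxx mulr1.
  rewrite big1 ?addr0 // => i.
  by rewrite -val_eqE /= => /negbTE ->; rewrite mulr0.
rewrite /op_entry deltaE /=; congr dotl2; apply: ell2P => j /=.
by rewrite deltaE /= addnC.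
Qed.

End HankelSquare.

(** * The theorem *)

Theorem theorem2p1 (R : realType) (T B : nat -> 'M[R]_2) (a : nat -> 'cV[R]_2)
    (a_rec : forall j : nat, a j.+1 = T j *m a j)
    (a_cvg0 : a @ \oo --> (0 : 'cV[R]_2))
    (Ba_summable : cvgn (series (fun j : nat => normcv (B j *m a j) ^+ 2)))
    (C : 'M[R]_2) (lambda : R)
    (C_sym : C^T = C)
    (C_eig0 : eigenvalue C 0)
    (C_eigl : eigenvalue C lambda)
    (lambda_lt0 : lambda < 0)
    (TBC : forall m n : nat, m <> n ->
       (m%:R - n%:R)^-1 *: ((T n)^T *m Jmx R *m T m - Jmx R)
       = (B n)^T *m C *m B m)
    (v : 'cV[R]_2)
    (v_eig : C *m v = lambda *: v)
    (v_unit : normcv v = 1) :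
  let phi : R^nat :=
    fun j => Num.sqrt `|lambda| * dotcv v (B j *m a j) in
  exists Gamma : {linear ell2 R -> ell2 R},
    [/\ has_matrix (hankel phi) Gamma,
        compact_operator Gamma &
        forall m n : nat, m <> n ->
          op_entry (Gamma \o Gamma) m n
          = dotcv (Jmx R *m a m) (a n) / (m%:R - n%:R)].
Proof.
move=> phi.
have phi_ell2 : phi \in @ell2_pred R.
  apply/ell2_predP.
  apply: series_le_cvg (is_cvg_seriesZ (k := `|lambda|) Ba_summable).
  - by move=> n; exact: sqr_ge0.
  - by move=> n; rewrite mulr_ge0 ?sqr_ge0.
  move=> n; rewrite /phi exprMn sqr_sqrtr //.
  by apply: ler_wpM2l => //; exact: dotcv2_sqr_le.
have a0 i : (fun n => a n i 0) @ \oo --> (0 : R).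
  rewrite [X in _ --> X](_ : _ = (0 : 'cV[R]_2) i 0); last by rewrite mxE.
  exact: (cvg_comp a (fun M : 'cV[R]_2 => M i 0) a_cvg0
    (@coord_continuous R 2 1 i 0 0)).
have wE m n : wronskian_entry (fun n => a n 0 0) (fun n => a n 1 0) m n
    = dotcv (Jmx R *m a m) (a n) / (m%:R - n%:R) by rewrite dotcv_Jmx.
have step m n : m <> n ->
    wronskian_entry (fun n => a n 0 0) (fun n => a n 1 0) m n
    - wronskian_entry (fun n => a n 0 0) (fun n => a n 1 0) m.+1 n.+1
    = phi m * phi n.
  move=> mn; rewrite !wE !a_rec !(dotcvC (Jmx R *m _)) -!natr1.
  have := congr1 (fun M : 'M_2 => dotcv (a n) (M *m a m)) (TBC m n mn).
  rewrite /= -scalemxAl mulmxBl dotcvZr dotcvBr -!mulmxA !dotcv_trmx.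
  rewrite (dotcv_sym_rank1 _ _ (ltr0_neq0 lambda_lt0) C_sym C_eig0 v_eig)//.
  have -> : m%:R + 1 - (n%:R + 1) = m%:R - n%:R :> R by ring.
  have -> : phi m * phi n
      = - (lambda * (dotcv v (B n *m a n) * dotcv v (B m *m a m))).
    rewrite /phi mulrACA -expr2 sqr_sqrtr // ltr0_norm //; ring.
  by move=> <-; ring.
have [Gamma [GammaE Gamma_compact Gamma_sqr]] :=
  hankel_square (phi := Ell2 phi_ell2) (a0 0) (a0 1) step.
by exists Gamma; split=> // m n mn; rewrite Gamma_sqr.
Qed.
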